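(* Let $X$ be a Fréchet sequence algebra for the coordinatewise product which admits a continuous norm. Assume that $(e_n)_{n\ge0}$ spans a dense subspace of $X$. Let $B_w$ be a bounded weighted backward shift on $X$ such that, for all integers $m\ge1$, the series $\sum_{n\ge1}(w_1\cdots w_n)^{-1/m}e_n$ converges unconditionally in $X$. Then $B_w$ admits an upper frequently hypercyclic algebra.
   Context: $\mathbb N=\{1,2,\dots\}$, $\mathbb N_0=\mathbb N\cup\{0\}$, $\omega=\mathbb C^{\mathbb N_0}$, and $e_n\in\omega$ is the sequence with $1$ in position $n$ and $0$ elsewhere. A Fréchet sequence algebra is a subspace $X$ of $\omega$ which is a Fréchet space (complete metrizable) for the topology induced by a non-decreasing sequence of seminorms $(\|\cdot\|_q)_{q\ge1}$, such that convergence in $X$ implies coordinatewise convergence, endowed with a product satisfying $\|x\cdot y\|_q\le\|x\|_q\|y\|_q$ for all $x,y\in X$, $q\ge1$. The coordinatewise product is $(x_n)\cdot(y_n)=(x_ny_n)$. $X$ admits a continuous norm if there is a norm on $X$ bounded by $C\|\cdot\|_q$ for some $q\ge1$, $C>0$. For a sequence $w=(w_n)_{n\ge1}$ of nonzero complex numbers, $B_w(x_0,x_1,\dots)=(w_1x_1,w_2x_2,\dots)$; ''bounded on $X$'' means that $B_w$ is a continuous linear operator from $X$ to $X$. For $z\in\mathbb C$, $z^{1/m}$ denotes any $m$-th root of $z$ (unconditional convergence does not depend on the choice). A series converges unconditionally if all its rearrangements converge. A vector $x\in X$ is upper frequently hypercyclic for $T$ if, for every non-empty open $U\subset X$, the set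 $\{n\in\mathbb N:T^nx\in U\}$ has positive upper density. An upper frequently hypercyclic algebra for $T$ is a subalgebra of $X$, different from $\{0\}$ and not required to be unital, all of whose nonzero elements are upper frequently hypercyclic vectors for $T$. *)

(* Defs.v *)
From HB Require Import structures.
From mathcomp Require Import all_boot all_order all_algebra.
From mathcomp Require Import complex.
From mathcomp Require Import all_classical all_reals all_analysis.

Set Implicit Arguments.
Unset Strict Implicit.
Unset Printing Implicit Defensive.

Import Order.TTheory GRing.Theory Num.Theory.
Import numFieldNormedType.Exports.

Local Open Scope classical_set_scope.
Local Open Scope ring_scope.
Local Open Scope complex_scope.

Section Seminorms.
Context (R : realType) (E : lmodType R[i]).

(* Real-valued, over the complex scalars. Nonnegativity and [N 0 = 0] follow. *)
Definition seminorm (N : E -> R) : Prop :=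
  (forall x y, N (x + y) <= N x + N y) /\
  (forall (a : R[i]) x, (N (a *: x))%:C = `|a| * (N x)%:C).

Definition separating_seminorm (N : E -> R) : Prop :=
  seminorm N /\ forall x, N x = 0 -> x = 0.

(* Indexed by q = 0, 1, 2, ... instead of q >= 1. *)
Record seminorm_seq := SeminormSeq {
  sn :> nat -> E -> R ;
  sn_seminorm : forall q, seminorm (sn q) ;
  sn_nondecreasing : forall x, nondecreasing_seq (sn ^~ x) }.

Lemma seminormN N x : seminorm N -> N (- x) = N x.
Proof.
case=> _ NZ; apply: complexI.
by rewrite -scaleN1r NZ normrN1 mul1r.
Qed.

Lemma seminorm0 N : seminorm N -> N 0 = 0.
Proof.
by case=> _ NZ; apply: complexI; rewrite -(scale0r 0) NZ normr0 mul0r.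
Qed.

Lemma sn_homo (p : seminorm_seq) q r x : (q <= r)%N -> p q x <= p r x.
Proof. by move=> qr; apply: sn_nondecreasing. Qed.

End Seminorms.

(* [E] with the uniform structure (hence the topology) generated by [p]. *)
Definition sn_space (R : realType) (E : lmodType R[i]) (p : seminorm_seq E) :
  Type := E.

Section SnUniform.
Context (R : realType) (E : lmodType R[i]) (p : seminorm_seq E).
Local Open Scope relation_scope.

HB.instance Definition _ := GRing.Lmodule.on (sn_space p).
HB.instance Definition _ := isPointed.Build (sn_space p) (0 : E).

Definition sn_ent : set_system (E * E) :=
  filter_from [set qe : nat * R | 0 < qe.2]
    (fun qe => [set xy | p qe.1 (xy.1 - xy.2) < qe.2]).

Let sn_ent_filter : Filter sn_ent.
Proof.
apply: filter_from_filter; first by exists (0%N, 1) => /=.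
move=> [q e] [r f] /= e0 f0; exists (maxn q r, Num.min e f) => /=.
  by rewrite lt_min e0 f0.
move=> [x y] /=; rewrite lt_min => /andP[le lf]; split => /=.
  by apply: le_lt_trans le; apply/sn_homo/leq_maxl.
by apply: le_lt_trans lf; apply/sn_homo/leq_maxr.
Qed.

Let sn_ent_refl A : sn_ent A -> diagonal `<=` A.
Proof.
move=> [[q e] /= e0 sub] [x y]; rewrite /diagonal /= => ->; apply: sub => /=.
by rewrite subrr seminorm0//; exact: sn_seminorm.
Qed.

Let sn_ent_inv A : sn_ent A -> sn_ent A^-1.
Proof.
move=> [[q e] /= e0 sub]; exists (q, e) => //= -[x y] /= xy.
apply: sub => /=; rewrite -opprB seminormN//; exact: sn_seminorm.
Qed.

Let sn_ent_split A : sn_ent A -> exists2 B, sn_ent B & B \; B `<=` A.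
Proof.
move=> [[q e] /= e0 sub].
exists [set xy | p q (xy.1 - xy.2) < e / 2].
  by exists (q, e / 2) => //=; rewrite divr_gt0.
move=> [x y] /= [z /= xz zy]; apply: sub => /=.
have -> : x - y = (x - z) + (z - y) by rewrite addrA subrK.
apply: le_lt_trans ((sn_seminorm p q).1 _ _) _.
by rewrite (splitr e) ltrD.
Qed.

HB.instance Definition _ := @isUniform.Build (sn_space p) sn_ent
  sn_ent_filter sn_ent_refl sn_ent_inv sn_ent_split.

End SnUniform.

Section SequenceSpaces.
Context (R : realType).

Definition subseqspace (X : submodClosed (nat -> R[i])) : Type :=
  {x : nat -> R[i] | x \in X}.

Context (X : submodClosed (nat -> R[i])).

HB.instance Definition _ := SubChoice.on (subseqspace X).
HB.instance Definition _ := [SubChoice_isSubLmodule of subseqspace X by <:].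

(* The ring product of [nat -> R[i]] is the coordinatewise one. [fsa_cvg_coord]
   makes the topology Hausdorff, hence, the sequence [p] being
   countable, metrizable. *)
Record frechet_sequence_algebra (p : seminorm_seq (subseqspace X)) : Prop := {
  fsa_complete : forall F : set_system (sn_space p),
    ProperFilter F -> cauchy F -> cvg F ;
  fsa_cvg_coord : forall (u : nat -> sn_space p) (x : sn_space p),
    u @ \oo --> x ->
    forall k : nat, (fun n => val (u n) k : (R[i] : numFieldType)) @ \oo -->
      (val x k : (R[i] : numFieldType)) ;
  fsa_mul_closed : GRing.mulr_2closed X ;
  fsa_submult : forall q (x y z : subseqspace X),
    val z = val x * val y -> p q z <= p q x * p q y }.

Definition has_continuous_norm (p : seminorm_seq (subseqspace X)) : Prop :=
  exists2 N : subseqspace X -> R, separating_seminorm N &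
    exists q, exists2 C : R, 0 < C & forall x, N x <= C * p q x.

Definition unit_seq (n : nat) : nat -> R[i] := fun k => (k == n)%:R.

Definition backward_shift (w : nat -> R[i]) (x : nat -> R[i]) : nat -> R[i] :=
  fun n => w n.+1 * x n.+1.

Definition subalgebra (A : {pred nat -> R[i]}) : Prop :=
  [/\ {subset A <= X}, submod_closed A & GRing.mulr_2closed A].

End SequenceSpaces.

Definition linear_span (K : nzRingType) (E : lmodType K) (e : nat -> E) :
  set E := [set x | exists n (c : nat -> K), x = \sum_(k < n) c k *: e k].

Definition unconditionally_cvg (R : realType) (E : lmodType R[i])
    (p : seminorm_seq E) (u : nat -> sn_space p) : Prop :=
  forall s : nat -> nat, bijective s -> cvgn (series (u \o s)).

Definition upper_density (R : realType) (A : set nat) : \bar R :=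
  limn_esup (fun N => ((\sum_(1 <= n < N.+1) \1_A n) / N%:R : R)%:E).

Definition upper_frequently_hypercyclic (R : realType) (E : topologicalType)
    (T : E -> E) (x : E) : Prop :=
  forall U : set E, open U -> U !=set0 ->
    (0 < upper_density R [set n | U (iter n T x)])%E.

Definition ufh_algebra (R : realType) (X : submodClosed (nat -> R[i]))
    (p : seminorm_seq (subseqspace X)) (T : sn_space p -> sn_space p)
    (A : {pred nat -> R[i]}) : Prop :=
  [/\ subalgebra X A,
      exists2 x, x \in A & x != 0 &
      forall x : sn_space p, val x \in A -> x != 0 ->
        upper_frequently_hypercyclic R T x].

(* Main.v *)
(* Write W_n = w_1 ... w_n. A vector u is built explicitly, stage by stage; each
   stage aims at a finitely supported target v, an exponent m and a precision,
   and every such triple (with v rational) recurs in infinitely many stages.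
   The stage occupies the positions [N, N(L+1)) and repeats with period L, at the
   times n = N + aL with a < N, the block whose (n+j)-th coordinate is an m-th
   root of v_j W_j / W_(n+j). At these times B_w^n(u^m) is v up to a tail of
   sum_i e_i / W_i, small once L is large; in B_w^n(u^k) with k > m the same
   series carries additional factors W_(n+j)^(-(k-m)/m), which tend to 0 since the
   continuous norm forces p_q(e_i) >= 1 and hence |W_i| -> oo. N is chosen so late
   that the stage is invisible to all earlier ones. The hitting times have upper
   density at least 1/(L+1), with L depending on the triple only. For a nonzero
   polynomial P vanishing at 0, the term of lowest degree of P(u) then dominates,
   so {P(u) : P(0) = 0} is the required algebra. *)
Require Import Defs.
From mathcomp Require Import all_boot all_order all_algebra.
From mathcomp Require Import complex.
From mathcomp Require Import all_classical all_reals all_analysis.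
From mathcomp Require Import ring lra.
Import Order.TTheory GRing.Theory Num.Theory.
Import numFieldNormedType.Exports.
Local Open Scope classical_set_scope.
Local Open Scope ring_scope.
Local Open Scope complex_scope.
Import Normc.
Set Implicit Arguments.
Unset Strict Implicit.
Unset Printing Implicit Defensive.

(** * Complex modulus and seminorms *)

Section ComplexModulus.
Context (R : realType).
Implicit Types z : R[i].

Lemma normrc z : `|z| = (normc z)%:C.
Proof. by []. Qed.

Lemma normc_ge0 z : 0 <= normc z.
Proof. by case: z => a b; exact: sqrtr_ge0. Qed.

Lemma normcX z n : normc (z ^+ n) = normc z ^+ n.
Proof.
by elim: n => [|n IHn]; rewrite ?expr0 ?normc1// !exprS normcM IHn.
Qed.

Lemma normc_real (a : R) : normc a%:C = `|a|.
Proof. by rewrite /= expr0n/= addr0 sqrtr_sqr. Qed.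

Lemma normc_gt0 z : z != 0 -> 0 < normc z.
Proof.
move=> z0; rewrite lt_def normc_ge0 andbT.
by apply: contra z0 => /eqP/eq0_normc ->.
Qed.

Lemma normcE z : normc z = Num.sqrt ((complex.Re z) ^+ 2 + (complex.Im z) ^+ 2).
Proof. by case: z. Qed.

Lemma normc_ge_abs_Re z : `|complex.Re z| <= normc z.
Proof.
by rewrite normcE -sqrtr_sqr ler_wsqrtr// lerDl sqr_ge0.
Qed.

Lemma normc_ge_abs_Im z : `|complex.Im z| <= normc z.
Proof.
by rewrite normcE -sqrtr_sqr ler_wsqrtr// lerDr sqr_ge0.
Qed.

Lemma normc_le_abs_ReIm z : normc z <= `|complex.Re z| + `|complex.Im z|.
Proof.
rewrite normcE -[leRHS]ger0_norm ?addr_ge0// -sqrtr_sqr ler_wsqrtr//.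
by rewrite sqrrD !real_normK ?num_real// lerD2r lerDl mulrn_wge0// mulr_ge0.
Qed.

End ComplexModulus.

Section SeminormBasics.
Context (R : realType) (E : lmodType R[i]) (p : seminorm_seq E).
Implicit Types (x y : E) (q : nat).

Lemma snD q x y : p q (x + y) <= p q x + p q y.
Proof. exact: (sn_seminorm p q).1. Qed.

Lemma snZ q a x : p q (a *: x) = normc a * p q x.
Proof.
by apply: complexI; rewrite (sn_seminorm p q).2 normrc rmorphM.
Qed.

Lemma sn0 q : p q 0 = 0.
Proof. exact/seminorm0/sn_seminorm. Qed.

Lemma snN q x : p q (- x) = p q x.
Proof. exact/seminormN/sn_seminorm. Qed.

Lemma snB q x y : p q (x - y) = p q (y - x).
Proof. by rewrite -snN opprB. Qed.

Lemma sn_ge0 q x : 0 <= p q x.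
Proof.
have := snD q x (- x); rewrite subrr sn0 snN -mulr2n.
by rewrite pmulrn_lge0.
Qed.

Lemma sn_sum q (I : Type) (s : seq I) (P : pred I) (F : I -> E) :
  p q (\sum_(i <- s | P i) F i) <= \sum_(i <- s | P i) p q (F i).
Proof.
elim/big_rec2: _ => [|i y1 y2 _ le]; first by rewrite sn0.
by apply: le_trans (snD _ _ _) _; rewrite lerD2l.
Qed.

Lemma sn_sum_nat q (F : nat -> E) (b : nat -> R) m n :
  (forall i, (m <= i < n)%N -> p q (F i) <= b i) ->
  p q (\sum_(m <= i < n) F i) <= \sum_(m <= i < n) b i.
Proof.
move=> Fb; apply: le_trans (sn_sum _ _ _ _) _.
by rewrite !big_nat ler_sum.
Qed.

End SeminormBasics.

(** * Convergence, completeness and continuity at 0 through the seminorms *)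

Section SeminormTopology.
Context (R : realType) (E : lmodType R[i]) (p : seminorm_seq E).

Lemma sn_entourage q (e : R) : 0 < e ->
  entourage ([set xy | p q (xy.1 - xy.2) < e] : set (sn_space p * sn_space p)).
Proof. by move=> e0; exists (q, e). Qed.

Lemma sn_cvgP (u : nat -> sn_space p) (l : sn_space p) :
  u @ \oo --> l <-> forall q (e : R), 0 < e ->
    exists N, forall n, (N <= n)%N -> p q (l - u n) < e.
Proof.
split=> [ul q e e0|ul].
  have /= := (@cvg_app_entourageP _ _ _ _ _ l).1 ul _ (sn_entourage q e0).
  by move=> [N _ NP]; exists N => n Nn; exact: NP.
apply/cvg_app_entourageP => A [[q e] /= e0 sub].
have [N NP] := ul q e e0.
by exists N => // n /= Nn; apply: sub; exact: NP.
Qed.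

Lemma sn_cvg_cauchy (u : nat -> sn_space p) : cvgn u -> forall q (e : R), 0 < e ->
  exists N, forall m n, (N <= m)%N -> (N <= n)%N -> p q (u m - u n) < e.
Proof.
move=> /cvg_ex[l /sn_cvgP ul] q e e0.
have [N NP] := ul q (e / 2) (divr_gt0 e0 (ltr0Sn _ _)).
exists N => m n Nm Nn.
have -> : u m - u n = (l - u n) - (l - u m) by rewrite opprB [RHS]addrC addrA subrK.
apply: le_lt_trans (snD _ _ _ _) _; rewrite snN (splitr e).
by rewrite ltrD// NP.
Qed.

Lemma sn_cauchy_cvg (u : nat -> sn_space p) :
  (forall F : set_system (sn_space p), ProperFilter F -> cauchy F -> cvg F) ->
  (forall q (e : R), 0 < e -> exists N, forall m n,
     (N <= m)%N -> (N <= n)%N -> p q (u m - u n) < e) ->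
  cvgn u.
Proof.
move=> complete uc; apply: complete => A [[q e] /= e0 sub].
have [N NP] := uc q e e0.
exists ([set x | exists2 n, (N <= n)%N & x = u n],
        [set x | exists2 n, (N <= n)%N & x = u n]).
  by split; exists N => // n /= Nn; exists n.
by move=> [x y] [/= [m Nm ->] [n Nn ->]]; apply: sub; exact: NP.
Qed.

Lemma sn_open_ball (U : set (sn_space p)) (x : sn_space p) :
  open U -> U x ->
  exists q, exists2 e : R, 0 < e & forall y, p q (x - y) < e -> U y.
Proof.
move=> Uo Ux.
have /nbhsP[A [[q e] /= e0 sub] AU] : nbhs x U by exact: open_nbhs_nbhs.
exists q, e => // y xy; apply: AU; apply/xsectionP; exact: sub.
Qed.

Lemma sn_continuous0 (T : sn_space p -> sn_space p) : continuous T ->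
  T 0 = 0 -> forall q (e : R), 0 < e ->
  exists r, exists2 d : R, 0 < d & forall x, p r x < d -> p q (T x) < e.
Proof.
move=> Tc T0 q e e0.
have : nbhs (T 0) [set y : sn_space p | p q y < e].
  apply/nbhsP; exists [set xy | p q (xy.1 - xy.2) < e].
    exact: sn_entourage.
  by move=> y /xsectionP /=; rewrite T0 sub0r snN.
move=> /(Tc 0) /nbhsP[A [[r d] /= d0 sub] AU].
exists r, d => // x xd; apply: (AU x); apply/xsectionP; apply: sub => /=.
by rewrite sub0r snN.
Qed.

End SeminormTopology.

(** * Unconditional convergence and bounded multipliers *)

Lemma injective_surjective_bijective (s : nat -> nat) :
  injective s -> (forall m, exists n, s n = m) -> bijective s.
Proof.
move=> sI /choice[g gK]; exists g => [n|n]; last exact: gK.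
by apply: sI; rewrite gK.
Qed.

(** The first [k] blocks concatenate to a permutation of [[0, N k)]; these prefixes are compatible,
    so they define one bijection. *)
Lemma block_permutation (N : nat -> nat) (b : nat -> seq nat) :
  N 0%N = 0%N -> (forall k, (N k < N k.+1)%N) ->
  (forall k, perm_eq (b k) (index_iota (N k) (N k.+1))) ->
  exists2 s : nat -> nat, bijective s &
    forall k i, (i < size (b k))%N -> s (N k + i)%N = nth 0%N (b k) i.
Proof.
move=> N0 Ninc bN.
pose L k := \big[cat/[::]]_(0 <= j < k) b j.
have LS k : L k.+1 = L k ++ b k by rewrite /L big_nat_recr.
have Lp k : perm_eq (L k) (iota 0 (N k)).
  elim: k => [|k IHk]; first by rewrite /L big_geq// N0.
  rewrite LS -[N k.+1](subnKC (ltnW (Ninc k))) iotaD add0n.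
  exact: perm_cat.
have Lsz k : size (L k) = N k by rewrite (perm_size (Lp k)) size_iota.
have kN k : (k <= N k)%N by elim: k => // k IHk; exact: leq_ltn_trans IHk (Ninc k).
have Nmono k l : (k <= l)%N -> (N k <= N l)%N.
  by move=> /subnK <-; elim: (l - k)%N => // j IHj; exact: leq_trans IHj (ltnW (Ninc _)).
(* The prefix [L n.+1] has length [N n.+1 > n], so the default of [nth] is never reached. *)
pose s n := nth 0%N (L n.+1) n.
have Lnth k j n : (n < N k)%N -> nth 0%N (L (k + j)%N) n = nth 0%N (L k) n.
  move=> nk; elim: j => [|j IHj]; first by rewrite addn0.
  by rewrite addnS LS nth_cat Lsz ifT// (leq_trans nk)// Nmono// leq_addr.
have sE k n : (n < N k)%N -> s n = nth 0%N (L k) n.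
  by move=> nk; rewrite -(Lnth k n.+1 n)// addnC Lnth//; exact: kN.
exists s.
  apply: injective_surjective_bijective => [m n|m].
    pose k := (maxn m n).+1.
    have mk : (m < N k)%N by apply: leq_trans (kN k); rewrite ltnS leq_maxl.
    have nk : (n < N k)%N by apply: leq_trans (kN k); rewrite ltnS leq_maxr.
    rewrite (sE k)// (sE k n)// => /eqP; rewrite nth_uniq ?Lsz//; first by move/eqP.
    by rewrite (perm_uniq (Lp k)) iota_uniq.
  have mL : m \in L m.+1 by rewrite (perm_mem (Lp _)) mem_iota/= kN.
  exists (index m (L m.+1)); rewrite (sE m.+1) ?nth_index//.
  by rewrite -Lsz index_mem.
move=> k i ib; rewrite (sE k.+1).
  by rewrite LS nth_cat Lsz ltnNge leq_addr/= addKn.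
by rewrite -(Lsz k.+1) LS size_cat Lsz ltn_add2l.
Qed.

Section UnconditionalConvergence.
Context (R : realType) (E : lmodType R[i]) (p : seminorm_seq E).
Implicit Types (x : nat -> E) (q : nat).

(* If finite subsums far out stay large, a permutation that lists each of them
   contiguously produces a divergent rearrangement. *)
Lemma unconditionally_cvg_subsums (x : nat -> sn_space p) :
  unconditionally_cvg x -> forall q (e : R), 0 < e ->
  exists N, forall (F : pred nat) K,
    p q (\sum_(N <= i < K) (if F i then x i else 0)) <= e.
Proof.
move=> ux q e e0; apply: contrapT => /forallNP h.
have {h} /choice[g gP] (N : nat) : exists FK : pred nat * nat, (N < FK.2)%N /\
    e < p q (\sum_(N <= i < FK.2) (if FK.1 i then x i else 0)).
  have /existsNP[F /existsNP[K /negP]] := h N; rewrite -ltNge => lt.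
  exists (F, K); split=> //=; rewrite ltnNge; apply: contraTN lt => KN.
  by rewrite big_geq// sn0 -leNgt ltW.
pose N k := iter k (fun n => (g n).2) 0%N.
pose I k := index_iota (N k) (N k.+1).
pose F k := (g (N k)).1.
pose b k := seq.filter (F k) (I k) ++ seq.filter (predC (F k)) (I k).
have [||k|s sb sE] := @block_permutation N b.
- by [].
- by move=> k; exact: (gP (N k)).1.
- exact/permEl/perm_filterC.
have [M MP] := sn_cvg_cauchy (ux s sb) q e0.
have kN k : (k <= N k)%N.
  by elim: k => // k IHk; exact: leq_ltn_trans IHk (gP (N k)).1.
pose f := seq.filter (F M) (I M).
have := MP (N M + size f)%N (N M) (leq_trans (kN M) (leq_addr _ _)) (kN M).
rewrite sub_series_geq ?leq_addr//.
rewrite -{1}[N M]add0n big_addn addKn /=.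
rewrite (_ : \sum_(0 <= i < size f) _ = \sum_(i <- f) x i).
  rewrite /f big_filter big_mkcond/= => lt.
  by have := lt_trans (gP (N M)).2 lt; rewrite ltxx.
rewrite [RHS](big_nth 0%N); apply: eq_big_nat => i /andP[_ isz].
rewrite addnC sE ?size_cat ?ltn_addr//.
by rewrite nth_cat isz.
Qed.

(** A seminorm is convex in each multiplier, so on the cube of multipliers it is largest at a
    vertex, that is, on a subsum. The vector [y] collects the terms already selected in the
    induction. *)
Lemma sn_le_unit_multipliers q x (e : R) y K :
  (forall F : pred nat,
     p q (y + \sum_(0 <= i < K) (if F i then x i else 0)) <= e) ->
  forall c : nat -> R, (forall i, 0 <= c i <= 1) ->
  p q (y + \sum_(0 <= i < K) (c i)%:C *: x i) <= e.
Proof.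
elim: K y => [|K IHK] y Fe c c01.
  by rewrite big_geq//; have := Fe xpred0; rewrite big_geq.
have recr G : \sum_(0 <= i < K.+1) (if G i then x i else 0) =
    \sum_(0 <= i < K) (if G i then x i else 0) + (if G K then x K else 0).
  by rewrite big_nat_recr.
have h0 : p q (y + \sum_(0 <= i < K) (c i)%:C *: x i) <= e.
  apply: IHK => // F; have := Fe (fun i => F i && (i != K)).
  rewrite recr eqxx andbF addr0; congr (p q (_ + _) <= _).
  by apply: eq_big_nat => i /andP[_ iK]; rewrite (ltn_eqF iK) andbT.
have h1 : p q (y + x K + \sum_(0 <= i < K) (c i)%:C *: x i) <= e.
  apply: IHK => // F; have := Fe (fun i => F i || (i == K)).
  rewrite recr eqxx orbT addrAC -addrA; congr (p q (_ + (_ + _)) <= _).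
  by apply: eq_big_nat => i /andP[_ iK]; rewrite (ltn_eqF iK) orbF.
rewrite big_nat_recr//=; set S := \sum_(0 <= i < K) _.
have /andP[c0 c1] := c01 K.
(* A convex combination of the choices 0 and 1 for the last multiplier. *)
have -> : y + (S + (c K)%:C *: x K) =
    (1 - c K)%:C *: (y + S) + (c K)%:C *: (y + x K + S).
  rewrite rmorphB rmorph1 scalerBl scale1r [y + x K + S]addrAC.
  by rewrite (scalerDr _ (y + S)) [RHS]addrA subrK addrA.
apply: le_trans (snD _ _ _ _) _; rewrite !snZ !normc_real.
rewrite !ger0_norm ?subr_ge0// -[leRHS]mul1r -[1 in leRHS](subrK (c K)) [leRHS]mulrDl.
by rewrite lerD// ler_wpM2l// subr_ge0.
Qed.

(** The vanishing of [a] below [N] encodes a sum starting at [N]. The multipliers later absorb block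
    coefficients and extra powers of roots. *)
Definition multiplier_summable x := forall q (e : R), 0 < e ->
  exists N, forall (a : nat -> R[i]) K, (forall i, normc (a i) <= 1) ->
    (forall i, (i < N)%N -> a i = 0) -> p q (\sum_(0 <= i < K) a i *: x i) <= e.

(** A complex multiplier splits into the positive and negative parts of its real and imaginary
    parts: four multipliers in [[0, 1]], each allowed an error [e / 4]. *)
Lemma unconditionally_cvg_multiplier (x : nat -> sn_space p) :
  unconditionally_cvg x -> multiplier_summable x.
Proof.
move=> ux q e e0.
have [N NP] := unconditionally_cvg_subsums ux q (divr_gt0 e0 (ltr0Sn _ 3)).
exists N => a K a1 aN.
have real_le (c : nat -> R) : (forall i, 0 <= c i <= 1) ->
    (forall i, (i < N)%N -> c i = 0) ->
    p q (\sum_(0 <= i < K) (c i)%:C *: x i) <= e / 4.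
  move=> c01 cN.
  (* With the terms before [N] set to zero, the sum starts at 0 and every subsum is still a tail
     subsum. *)
  rewrite (eq_bigr (fun i => (c i)%:C *: (if (N <= i)%N then x i else 0))).
    rewrite -[X in p q X]add0r; apply: sn_le_unit_multipliers => // F.
    rewrite add0r; have := NP F K; congr (p q _ <= _).
    have [NK|KN] := leqP N K; last first.
      rewrite [LHS]big_geq ?(ltnW KN)// [RHS]big_nat big1// => i /andP[_ iK].
      by case: ifP => // _; rewrite leqNgt (ltn_trans iK KN).
    rewrite [RHS](@big_cat_nat _ _ _ N)//= [X in _ = X + _]big_nat.
    rewrite [X in _ = X + _]big1 ?add0r.
      by apply: eq_big_nat => i /andP[-> _].
    by move=> i /andP[_ iN]; rewrite leqNgt iN; case: ifP.
  move=> i _; case: leqP => // iN; by rewrite cN// scale0r scaler0.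
pose pos (r : R) := Num.max 0 r.
have pos_bound (r : R) : `|r| <= 1 -> 0 <= pos r <= 1.
  by move=> r1; rewrite /pos le_max lexx ge_max ler01 (le_trans (ler_norm r)).
have posE (r : R) : r = pos r - pos (- r).
  rewrite /pos; case: (leP 0 r) => r0.
    by rewrite max_l ?subr0// oppr_le0.
  by rewrite max_r ?sub0r ?opprK// oppr_ge0 ltW.
have aE i : a i *: x i =
    ((pos (complex.Re (a i)))%:C *: x i - (pos (- complex.Re (a i)))%:C *: x i) +
    'i%C *: ((pos (complex.Im (a i)))%:C *: x i
            - (pos (- complex.Im (a i)))%:C *: x i).
  rewrite -!scalerBl scalerA -scalerDl; congr (_ *: _).
  by rewrite -!rmorphB -!posE -complexE.
rewrite (eq_bigr _ (fun i _ => aE i)) big_split/= -scaler_sumr !sumrB.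
have Re1 i : `|complex.Re (a i)| <= 1 := le_trans (normc_ge_abs_Re _) (a1 i).
have Im1 i : `|complex.Im (a i)| <= 1 := le_trans (normc_ge_abs_Im _) (a1 i).
have pos0 : pos 0 = 0 by rewrite /pos maxxx.
apply: le_trans (snD _ _ _ _) _.
rewrite snZ (_ : normc 'i%C = 1); last first.
  by rewrite /= expr0n/= add0r expr1n sqrtr1.
rewrite mul1r.
have -> : e = (e / 4 + e / 4) + (e / 4 + e / 4) by lra.
apply: lerD; (apply: le_trans (snD _ _ _ _) _; rewrite snN; apply: lerD);
  apply: real_le => i; rewrite ?pos_bound ?normrN// => iN;
  by rewrite aN//= ?oppr0 pos0.
Qed.

Lemma multiplier_summable_tail x : multiplier_summable x ->
  forall q (e C : R), 0 < e -> 0 < C ->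
  exists N, forall (a : nat -> R[i]) K, (forall i, normc (a i) <= C) ->
    (forall i, (i < N)%N -> a i = 0) -> p q (\sum_(0 <= i < K) a i *: x i) <= e.
Proof.
move=> sx q e C e0 C0; have [N NP] := sx q (e / C) (divr_gt0 e0 C0).
exists N => a K aC aN.
have Cne : C%:C != 0 :> R[i] by rewrite eq_complex/= gt_eqF.
rewrite (eq_bigr (fun i => C%:C *: ((C%:C^-1 * a i) *: x i))); last first.
  by move=> i _; rewrite scalerA mulrA divff// mul1r.
rewrite -scaler_sumr snZ normc_real gtr0_norm// mulrC -ler_pdivlMr//.
apply: NP => i; last by move=> iN; rewrite aN// mulr0.
by rewrite normcM normcV normc_real gtr0_norm// mulrC ler_pdivrMr// mul1r.
Qed.

(** The head is bounded term by term and the tail by 1 after division by [C]. Linearity in [C] is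
    what makes small multipliers give small sums. *)
Lemma multiplier_summable_bound x : multiplier_summable x ->
  forall q, exists2 B : R, 0 < B &
  forall (C : R) (a : nat -> R[i]) K, 0 < C -> (forall i, normc (a i) <= C) ->
    p q (\sum_(0 <= i < K) a i *: x i) <= C * B.
Proof.
move=> sx q; have [N NP] := sx q 1 ltr01.
pose B0 := \sum_(0 <= i < N) p q (x i).
have B00 : 0 <= B0 by apply: sumr_ge0 => i _; exact: sn_ge0.
exists (B0 + 1); first by rewrite ltr_wpDl.
move=> C a K C0 aC.
have Cne : C%:C != 0 :> R[i] by rewrite eq_complex/= gt_eqF.
pose a1 i := if (i < N)%N then a i else 0.
pose a2 i := if (i < N)%N then 0 else C%:C^-1 * a i.
rewrite (eq_bigr (fun i => a1 i *: x i + C%:C *: (a2 i *: x i))); last first.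
  move=> i _; rewrite /a1 /a2; case: ifP => _.
    by rewrite scale0r scaler0 addr0.
  by rewrite scale0r add0r scalerA mulrA divff// mul1r.
rewrite big_split/= -scaler_sumr; apply: le_trans (snD _ _ _ _) _.
rewrite mulrDr lerD//; last first.
  rewrite snZ normc_real gtr0_norm// ler_pM2l//.
  apply: NP => i; last by move=> iN; rewrite /a2 iN.
  rewrite /a2; case: ifP => _; first by rewrite normc0.
  by rewrite normcM normcV normc_real gtr0_norm// mulrC ler_pdivrMr// mul1r.
apply: le_trans (sn_sum _ _ _ _ _) _.
have h i : p q (a1 i *: x i) <= if (i < N)%N then C * p q (x i) else 0.
  rewrite snZ /a1; case: ifP => _; last by rewrite normc0 mul0r.
  by rewrite ler_wpM2r// sn_ge0.
apply: (@le_trans _ _ (\sum_(0 <= i < maxn K N) if (i < N)%N then C * p q (x i) else 0)).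
  rewrite [leRHS](@big_cat_nat _ _ _ K)//= ?leq_maxl//.
  rewrite -[leLHS]addr0 lerD//; first exact: ler_sum.
  by apply: sumr_ge0 => i _; case: ifP => // _; rewrite mulr_ge0 ?sn_ge0// ltW.
rewrite (@big_cat_nat _ _ _ N)//= ?leq_maxr// [X in _ + X]big_nat [X in _ + X]big1 ?addr0.
  by rewrite /B0 mulr_sumr [leLHS]big_nat [leRHS]big_nat; apply: ler_sum => i /andP[_ ->].
by move=> i /andP[Ni _]; rewrite ltnNge Ni.
Qed.

End UnconditionalConvergence.

(** * Dyadic series in a Frechet sequence algebra *)

Section DyadicSeries.
Context (R : realType).

(** The bound on [y s] covers only the seminorms [q <= s], so in a fixed seminorm the series is
    geometric from index [q] on. *)
Lemma sn_dyadic_series (E : lmodType R[i]) (p : seminorm_seq E)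
    (y : nat -> sn_space p) :
  (forall F : set_system (sn_space p), ProperFilter F -> cauchy F -> cvg F) ->
  (forall q s, (q <= s)%N -> p q (y s) <= 2^-1 ^+ s) ->
  exists2 l : sn_space p, series y @ \oo --> l &
    forall q n, (q <= n)%N -> p q (l - series y n) <= 2 * 2^-1 ^+ n.
Proof.
move=> complete yb.
have tail q m n : (q <= n)%N -> (n <= m)%N ->
    p q (series y m - series y n) <= 2 * 2^-1 ^+ n.
  move=> qn nm; rewrite sub_series_geq//.
  (* The exact geometric sum, unlike its upper bound, goes through the induction on [m]. *)
  suff h : p q (\sum_(n <= k < m) y k) <= 2 * 2^-1 ^+ n - 2 * 2^-1 ^+ m.
    by apply: le_trans h _; rewrite gerBl mulr_ge0// exprn_ge0// invr_ge0.
  elim: m nm => [|m IHm]; first by rewrite leqn0 => /eqP ->; rewrite big_geq// sn0 subrr.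
  rewrite leq_eqVlt ltnS => /predU1P[<-|nm].
    by rewrite big_geq// sn0 subrr.
  rewrite big_nat_recr//=; apply: le_trans (snD _ _ _ _) _.
  have := lerD (IHm nm) (yb q m (leq_trans qn nm)); rewrite exprS; lra.
have dyadic0 (e : R) : 0 < e -> exists N, 2 * 2^-1 ^+ N < e.
  move=> e0; have [N] := ltr_add_invr e0.
  rewrite add0r => Ne; exists N.+1; rewrite exprS mulrA divff// mul1r.
  apply: le_lt_trans Ne; rewrite exprVn lef_pV2 ?posrE ?exprn_gt0 ?ltr0n//.
  by rewrite -natrX ler_nat ltn_expl.
have /cvg_ex[l ul] : cvgn (series y).
  apply: sn_cauchy_cvg => // q e /dyadic0[N Ne].
  have Ne' n : (N <= n)%N -> 2 * 2^-1 ^+ n < e.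
    move=> Nn; apply: le_lt_trans Ne; rewrite ler_pM2l//.
    by rewrite ler_wiXn2l// ?invr_ge0// invf_le1// ler1n.
  exists (maxn N q) => m n; rewrite !geq_max => /andP[Nm qm] /andP[Nn qn].
  have [nm|mn] := leqP n m; first exact: le_lt_trans (tail _ _ _ qn nm) (Ne' _ Nn).
  rewrite snB; exact: le_lt_trans (tail _ _ _ qm (ltnW mn)) (Ne' _ Nm).
exists l => // q n qn; apply/ler_addgt0Pr => e e0.
have [M MP] := (sn_cvgP _ _).1 ul q e e0.
have := MP (maxn M n) (leq_maxl _ _); set m := maxn M n => lm.
have -> : l - series y n = (series y m - series y n) + (l - series y m).
  by rewrite [RHS]addrC addrA subrK.
by apply: le_trans (snD _ _ _ _) _; rewrite lerD ?tail ?leq_maxr// ltW.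
Qed.

Context (X : submodClosed (nat -> R[i])) (p : seminorm_seq (subseqspace X)).
Context (hX : frechet_sequence_algebra p).

Lemma val_sum (I : Type) (s : seq I) (P : pred I) (F : I -> subseqspace X) k :
  val (\sum_(i <- s | P i) F i) k = \sum_(i <- s | P i) val (F i) k.
Proof. by elim/big_rec2: _ => // i y1 y2 _ <-. Qed.

(** Continuity of the coordinates identifies the limit; this is how an explicit sequence [U] is
    shown to lie in [X]. *)
Lemma fsa_dyadic_series (y : nat -> subseqspace X) (U : nat -> R[i]) :
  (forall q s, (q <= s)%N -> p q (y s) <= 2^-1 ^+ s) ->
  (forall k, exists M, forall n, (M <= n)%N ->
     \sum_(0 <= s < n) val (y s) k = U k) ->
  exists2 l : subseqspace X, val l = U &
    forall q n, (q <= n)%N ->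
      p q (l - \sum_(0 <= s < n) y s) <= 2 * 2^-1 ^+ n.
Proof.
move=> yb yU; have [l yl lb] := sn_dyadic_series (fsa_complete hX) yb.
exists l => //; apply/funext => k.
have [M MU] := yU k.
have kl := @fsa_cvg_coord _ _ _ hX _ _ yl k.
have kU : (fun n => val (series y n) k : (R[i] : numFieldType)) @ \oo -->
    (U k : (R[i] : numFieldType)).
  apply: cvg_near_cst; exists M => // n /= Mn.
  by rewrite seriesEnat/= val_sum MU.
exact: (@norm_cvg_unique _ (R[i] : numFieldType) _ _ _ _ kl kU).
Qed.

End DyadicSeries.

(** * Weighted shifts and the parameters of a stage *)

Section WeightedShift.
Context (R : realType) (X : submodClosed (nat -> R[i])).
Context (p : seminorm_seq (subseqspace X)) (e : nat -> subseqspace X).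
Context (he : forall n, val (e n) = unit_seq R n).

Definition basis_sum K (a : nat -> R[i]) : subseqspace X :=
  \sum_(0 <= i < K) a i *: e i.

Lemma val_basis_sum K a k :
  val (basis_sum K a) k = if (k < K)%N then a k else 0.
Proof.
rewrite val_sum (eq_bigr (fun i => if i == k then a i else 0)); last first.
  move=> i _; rewrite [LHS](_ : _ = a i * val (e i) k)// he /unit_seq.
  by rewrite eq_sym; case: eqP => _; rewrite ?mulr1 ?mulr0.
by rewrite -big_mkcond big_nat1_eq.
Qed.

Lemma basis_sum_scale K (a x : nat -> R[i]) :
  basis_sum K (fun i => a i * x i) = \sum_(0 <= i < K) a i *: (x i *: e i).
Proof. by apply: eq_bigr => i _; rewrite scalerA. Qed.

(** [e n] is idempotent, so submultiplicativity gives [p q (e n) <= p q (e n) ^+ 2]; the continuous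
    norm makes [p q (e n)] nonzero for large [q]. *)
Lemma continuous_norm_unit_ge1 : frechet_sequence_algebra p ->
  has_continuous_norm p ->
  exists q0, forall q n, (q0 <= q)%N -> 1 <= p q (e n).
Proof.
move=> hX [N [sN Nsep] [q0 [C C0 NC]]]; exists q0 => q n q0q.
have N_ge0 x : 0 <= N x.
  have := sN.1 x (- x); rewrite subrr (seminorm0 sN) (seminormN _ sN) -mulr2n.
  by rewrite pmulrn_lge0.
have pos : 0 < p q (e n).
  rewrite lt_def sn_ge0 andbT; apply/negP => /eqP pe0.
  have : e n = 0.
    apply: Nsep; apply/eqP; rewrite eq_le N_ge0 andbT.
    apply: le_trans (NC _) _; rewrite pmulr_rle0//.
    by rewrite -pe0; exact: sn_homo.
  move=> /(congr1 (fun x => val x n)); rewrite he /unit_seq eqxx => /eqP.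
  by rewrite oner_eq0.
have := @fsa_submult _ _ _ hX q (e n) (e n) (e n).
rewrite -ler_pdivrMl// mulVf ?gt_eqF//; apply.
apply/funext => k; rewrite he /unit_seq.
change ((k == n)%:R = (k == n)%:R * (k == n)%:R :> R[i]).
by case: eqP; rewrite ?mulr1 ?mulr0.
Qed.

Context (w : nat -> R[i]) (hw : forall n, (0 < n)%N -> w n != 0).

Definition weight_prod n := \prod_(1 <= k < n.+1) w k.
Local Notation W := weight_prod.

Lemma weight_prod0 : W 0 = 1.
Proof. by rewrite /W big_geq. Qed.

Lemma weight_prodS n : W n.+1 = W n * w n.+1.
Proof. by rewrite /W big_nat_recr. Qed.

Lemma weight_prod_neq0 n : W n != 0.
Proof.
elim: n => [|n IHn]; first by rewrite weight_prod0 oner_eq0.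
by rewrite weight_prodS mulf_neq0// hw.
Qed.

Context (T : subseqspace X -> subseqspace X).
Context (hT : forall x, val (T x) = backward_shift w (val x)).

Lemma val_iter_shift n x k :
  val (iter n T x) k = W (n + k) / W k * val x (n + k)%N.
Proof.
elim: n k => [|n IHn] k.
  by rewrite /= add0n divff ?mul1r// weight_prod_neq0.
rewrite iterS hT /backward_shift IHn addnS addSn (weight_prodS k) mulrA; congr (_ * _).
by rewrite invfM mulrCA; congr (_ * _); rewrite mulrCA divff ?mulr1// hw.
Qed.

Context (rt : nat -> nat -> R[i]).
Context (hrt : forall m i, (0 < m)%N -> rt m i ^+ m * W i = 1).
Context (hsum : forall m, (0 < m)%N -> multiplier_summable p (fun i => rt m i *: e i)).

(** A single term [rt m i *: e i] is a multiplier sum far out, and for large [q] its seminorm is at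
    least the modulus of the root. *)
Lemma unit_root_vanishing m (d : R) :
  frechet_sequence_algebra p -> has_continuous_norm p -> (0 < m)%N -> 0 < d ->
  exists N, forall i, (N <= i)%N -> normc (rt m i) <= d.
Proof.
move=> hX hn m0 d0; have [q0 q0P] := continuous_norm_unit_ge1 hX hn.
have [N NP] := hsum m0 q0 d0; exists N => i Ni.
have := NP (fun k => (k == i)%:R) i.+1.
rewrite big_nat_recr//= eqxx scale1r big_nat big1; last first.
  by move=> k /andP[_ ki]; rewrite ltn_eqF// scale0r.
rewrite add0r snZ => h; apply: le_trans (h _ _).
- by rewrite ler_peMr ?normc_ge0// q0P.
- by move=> k; case: eqP => _; rewrite ?normc1 ?normc0.
- by move=> k kN; rewrite ltn_eqF// (leq_trans kN).
Qed.

(** Brings such sums under the summability hypothesis with exponent 1, as [rt 1 i] is the inverse of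
    [W i]. *)
Lemma basis_sum_div K (a : nat -> R[i]) :
  basis_sum K (fun i => a i / W i) = \sum_(0 <= i < K) a i *: (rt 1 i *: e i).
Proof.
rewrite basis_sum_scale; apply: eq_bigr => i _; congr (_ *: (_ *: _)).
have := @hrt 1 i isT; rewrite expr1 => h.
by rewrite -[LHS]mul1r -h mulfK// weight_prod_neq0.
Qed.

Record stage_data := StageData {
  sd_coef : nat -> R[i] ;
  sd_bound : R ;
  sd_gap : nat ;
  sd_small : R }.

(* [sd_coef] holds [m]-th roots of [v j * W j], bounded by [sd_bound]; blocks
   are repeated with period [sd_gap], and [sd_small] bounds the roots
   [rt m i] used in the stage. *)
Record stage_data_for (v : nat -> R[i]) (m r : nat) (D : stage_data) : Prop := {
  sd_coefE : forall j, sd_coef D j ^+ m = v j * W j ;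
  sd_bound_ge1 : 1 <= sd_bound D ;
  sd_coef_le : forall j, normc (sd_coef D j) <= sd_bound D ;
  sd_gap_gt0 : (0 < sd_gap D)%N ;
  sd_gap_supp : forall j, (sd_gap D <= j)%N -> v j = 0 ;
  sd_small_gt0 : 0 < sd_small D <= 1 ;
  sd_gap_tail : forall K a, (forall i, normc (a i) <= sd_bound D ^+ m) ->
    (forall i, (i < sd_gap D)%N -> a i = 0) ->
    p r (basis_sum K (fun i => a i / W i)) <= r.+1%:R^-1 ;
  sd_small_le : forall K a,
    (forall i, normc (a i) <= sd_bound D ^+ r.+1 * sd_small D) ->
    p r (basis_sum K (fun i => a i / W i)) <= r.+1%:R^-1 }.

(** Once the roots [c j] and their bound [C] are fixed, the gap comes from the tail of the series
    with exponent 1 for multipliers bounded by [C ^+ m], and [eta] from the linear bound for the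
    same series. *)
Lemma stage_data_exists (v : nat -> R[i]) d m r : (0 < m)%N ->
  (forall j, (d <= j)%N -> v j = 0) -> exists D, stage_data_for v m r D.
Proof.
move=> m0 vd; pose c j := m.-root (v j * W j).
have cE j : c j ^+ m = v j * W j by exact: rootCK.
have cd j : (d <= j)%N -> c j = 0 by move=> dj; rewrite /c vd// mul0r rootC0.
pose C := 1 + \sum_(0 <= j < d) normc (c j).
have C1 : 1 <= C by rewrite lerDl sumr_ge0// => j _; exact: normc_ge0.
have C0 : 0 < C by apply: lt_le_trans C1.
have cC j : normc (c j) <= C.
  have [jd|dj] := ltnP j d; last by rewrite cd// normc0 ltW.
  rewrite /C (@big_cat_nat _ _ _ j)//= ?(ltnW jd)// [X in _ + (_ + X)]big_ltn//.
  have S0 k l : 0 <= \sum_(k <= i < l) normc (c i).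
    by apply: sumr_ge0 => i _; exact: normc_ge0.
  by have := S0 0%N j; have := S0 j.+1 d; lra.
have r0 : 0 < r.+1%:R^-1 :> R by rewrite invr_gt0.
have [N NP] := multiplier_summable_tail (hsum (ltn0Sn 0)) r r0 (exprn_gt0 m C0).
have [B B0 BP] := multiplier_summable_bound (hsum (ltn0Sn 0)) r.
(* Chosen so that [C ^+ r.+1 * eta * B] is at most [r.+1%:R^-1]. *)
pose eta := Num.min 1 (r.+1%:R^-1 / (C ^+ r.+1 * B)).
have CB0 : 0 < C ^+ r.+1 * B by rewrite mulr_gt0// exprn_gt0.
have eta0 : 0 < eta by rewrite lt_min ltr01 divr_gt0.
exists (StageData c C (maxn d N).+1 eta); split => //=.
- by move=> j dj; apply: vd; apply: leq_trans (ltnW dj); exact: leq_maxl.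
- by rewrite eta0 ge_min lexx.
- move=> K a aC aN; rewrite basis_sum_div; apply: NP => // i iN; apply: aN.
  by rewrite ltnS (leq_trans (ltnW iN))// leq_maxr.
- move=> K a aC; rewrite basis_sum_div.
  apply: le_trans (BP (C ^+ r.+1 * eta) a K _ aC) _.
    by rewrite mulr_gt0// exprn_gt0.
  by rewrite mulrAC mulrC -ler_pdivlMr// ge_min lexx orbT.
Qed.

(** Only the finitely many iterates [n <= H] matter, each continuous at 0, so smallness reduces to a
    tail of the series of exponent [m]. In a [k]-th power one root stays in that series; the other
    [k - 1], of modulus at most 1, go into the multiplier. *)
Lemma stage_start_exists (Tc : continuous (T : sn_space p -> sn_space p))
    (m S H : nat) (C d : R) :
  frechet_sequence_algebra p -> has_continuous_norm p ->
  (0 < m)%N -> 1 <= C -> 0 < d <= 1 ->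
  exists N, [/\ (0 < N)%N, (H <= N)%N,
    forall i, (N <= i)%N -> normc (rt m i) <= d &
    forall q n k, (q <= S)%N -> (n <= H)%N -> (0 < k <= S.+1)%N ->
      forall K (a : nat -> R[i]), (forall i, normc (a i) <= C) ->
        (forall i, (i < N)%N -> a i = 0) ->
        p q (iter n T (basis_sum K (fun i => (a i * rt m i) ^+ k)))
          <= 2^-1 ^+ S].
Proof.
move=> hX hn m0 C1 /andP[d0 d1].
have C0 : 0 < C by apply: lt_le_trans C1.
have [N0 N0P] := unit_root_vanishing hX hn m0 d0.
have e0 : 0 < 2^-1 ^+ S :> R by rewrite exprn_gt0 ?invr_gt0.
have iterT0 n : iter n T 0 = 0.
  by apply/val_inj/funext => k; rewrite val_iter_shift mulr0.
have iterTc n : continuous (iter n T : sn_space p -> sn_space p).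
  elim: n => [|n IHn] x; first exact: cvg_id.
  apply: (@continuous_comp _ _ _ (iter n T : sn_space p -> sn_space p)).
    exact: IHn.
  exact: Tc.
have tail n : exists N, forall K (a : nat -> R[i]),
    (forall i, normc (a i) <= C ^+ S.+1) -> (forall i, (i < N)%N -> a i = 0) ->
    p S (iter n T (basis_sum K (fun i => a i * rt m i))) <= 2^-1 ^+ S.
  have [r [b b0 bP]] := sn_continuous0 (iterTc n) (iterT0 n) S e0.
  (* Half of [b] turns the weak bound into the strict one that continuity requires. *)
  have [N NP] := multiplier_summable_tail (hsum m0) r
    (divr_gt0 b0 (ltr0Sn _ 1)) (exprn_gt0 S.+1 C0).
  exists N => K a aC aN; apply/ltW/bP; rewrite basis_sum_scale.
  by apply: le_lt_trans (NP _ _ aC aN) _; rewrite gtr_pMr// invf_lt1// ltr1n.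
have {tail} [N1 N1P] := choice tail.
(* [N0] makes the roots small, [H] separates the stages, the maximum serves all iterates at once,
   and the successor makes [N] positive. *)
pose N := (maxn N0 (maxn H (\max_(n < H.+1) N1 n))).+1.
exists N; split => //.
- by rewrite ltnW// ltnS leq_max leq_max leqnn orbT.
- by move=> i Ni; apply/N0P/(leq_trans _ (ltnW Ni))/leq_maxl.
move=> q n k qS nH /andP[k0 kS] K a aC aN.
apply: le_trans (sn_homo _ _ qS) _.
have rt1 i : (N <= i)%N -> normc (rt m i) <= 1.
  by move=> Ni; apply: le_trans d1; apply/N0P/(leq_trans _ (ltnW Ni))/leq_maxl.
rewrite (_ : basis_sum _ _ =
    basis_sum K (fun i => a i ^+ k * rt m i ^+ k.-1 * rt m i)); last first.
  by apply: eq_bigr => i _; rewrite exprMn -mulrA -exprSr prednK.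
apply: N1P => i.
  have [iN|Ni] := ltnP i N.
    by rewrite aN// expr0n gtn_eqF//= mul0r normc0 exprn_ge0// ltW.
  rewrite normcM !normcX -[leRHS]mulr1; apply: ler_pM.
  - by rewrite exprn_ge0// normc_ge0.
  - by rewrite exprn_ge0// normc_ge0.
  - apply: (@le_trans _ _ (C ^+ k)); last exact: ler_weXn2l.
    by rewrite lerXn2r// nnegrE ?normc_ge0// ltW.
  - by rewrite exprn_ile1 ?normc_ge0// rt1.
move=> iN1; rewrite aN ?expr0n ?gtn_eqF//= ?mul0r// /N ltnS.
apply/ltnW/(leq_trans iN1); rewrite !leq_max; apply/orP; right; apply/orP; right.
by rewrite -[n]/(val (Ordinal (nH : (n < H.+1)%N))) leq_bigmax.
Qed.

End WeightedShift.

(** * Superposition of the stages *)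

Section Stages.
Context (R : realType) (X : submodClosed (nat -> R[i])).
Context (p : seminorm_seq (subseqspace X)) (e : nat -> subseqspace X).
Context (hX : frechet_sequence_algebra p).
Context (he : forall n, val (e n) = unit_seq R n).
Context (w : nat -> R[i]) (hw : forall n, (0 < n)%N -> w n != 0).
Context (T : subseqspace X -> subseqspace X).
Context (hT : forall x, val (T x) = backward_shift w (val x)).
Context (rt : nat -> nat -> R[i]).
Context (hrt : forall m i, (0 < m)%N -> rt m i ^+ m * weight_prod w i = 1).
Context (v : nat -> nat -> R[i]) (m r : nat -> nat) (D : nat -> stage_data R).
Context (N H : nat -> nat).
Context (hm : forall s, (0 < m s)%N).
Context (hD : forall s, stage_data_for p e w (v s) (m s) (r s) (D s)).
Context (hN : forall s, (0 < N s)%N) (hHN : forall s, (H s <= N s)%N).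
Context (hHS : forall s, H s.+1 = (N s * (sd_gap (D s)).+1)%N).
Context (hrtN : forall s i, (N s <= i)%N -> normc (rt (m s) i) <= sd_small (D s)).
Context (hsmall : forall s q n k, (q <= s)%N -> (n <= H s)%N ->
  (0 < k <= s.+1)%N -> forall K (a : nat -> R[i]),
    (forall i, normc (a i) <= sd_bound (D s)) ->
    (forall i, (i < N s)%N -> a i = 0) ->
    p q (iter n T (basis_sum e K (fun i => (a i * rt (m s) i) ^+ k)))
      <= 2^-1 ^+ s).
Local Notation W := (weight_prod w).
Local Notation L s := (sd_gap (D s)).

(** [H s] ends the earlier stages; [H s.+1 = N s + N s * L s] leaves room for exactly [N s] blocks
    of length [L s]. *)
Definition stage_coef s i : R[i] :=
  if (N s <= i < H s.+1)%N then sd_coef (D s) ((i - N s) %% L s)%N else 0.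

Definition stage_entry s i := stage_coef s i * rt (m s) i.

Definition stage_power s k := basis_sum e (H s.+1) (fun i => stage_entry s i ^+ k).

Lemma stage_end_lt s : (H s < H s.+1)%N.
Proof.
apply: leq_ltn_trans (hHN s) _; rewrite hHS ltn_Pmulr// ltnS.
exact: sd_gap_gt0 (hD s).
Qed.

Lemma stage_end_homo s t : (s <= t)%N -> (H s <= H t)%N.
Proof.
move=> /subnK <-; elim: (t - s)%N => // j IHj.
by apply: leq_trans IHj _; exact/ltnW/stage_end_lt.
Qed.

Lemma stage_entry_out s i : ~~ (N s <= i < H s.+1)%N -> stage_entry s i = 0.
Proof. by move=> /negPf si; rewrite /stage_entry /stage_coef si mul0r. Qed.

Lemma stage_entry_disjoint s t i :
  (N s <= i < H s.+1)%N -> t != s -> stage_entry t i = 0.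
Proof.
move=> /andP[Ni iH]; rewrite neq_ltn => /orP[ts|st]; apply: stage_entry_out;
  rewrite negb_and -!leqNgt -ltnNge.
  by rewrite (leq_trans (stage_end_homo ts) (leq_trans (hHN s) Ni)) orbT.
by rewrite (leq_trans iH (leq_trans (stage_end_homo st) (hHN t))).
Qed.

Lemma stage_entry_unique i : exists s, forall t, t != s -> stage_entry t i = 0.
Proof.
have [[s si]|no] := pselect (exists s, (N s <= i < H s.+1)%N).
  by exists s => t; exact: stage_entry_disjoint.
(* All entries vanish at an index outside every stage, so 0 is a harmless default. *)
exists 0%N => t _; apply: stage_entry_out; apply/negP => ti; apply: no; by exists t.
Qed.

Definition stage_of i := sval (cid (stage_entry_unique i)).

Lemma stage_ofP i t : t != stage_of i -> stage_entry t i = 0.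
Proof. by rewrite /stage_of; case: cid => s /= sP; exact: sP. Qed.

Definition stage_vector i := stage_entry (stage_of i) i.

(** The stages have disjoint supports, so taking powers commutes with summing over them; [0 < k]
    excludes [0 ^+ 0 = 1]. *)
Lemma sum_stage_entry i n k : (stage_of i < n)%N -> (0 < k)%N ->
  \sum_(0 <= s < n) stage_entry s i ^+ k = stage_vector i ^+ k.
Proof.
move=> sn k0.
rewrite (eq_bigr (fun s => if s == stage_of i then stage_entry s i ^+ k else 0)).
  by rewrite -big_mkcond big_nat1_eq sn.
by move=> s _; case: ifPn => // /stage_ofP ->; rewrite expr0n gtn_eqF.
Qed.

Lemma val_stage_power s k i : (0 < k)%N ->
  val (stage_power s k) i = stage_entry s i ^+ k.
Proof.
move=> k0; rewrite val_basis_sum//; case: ifPn => // /negPf iH.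
by rewrite stage_entry_out ?iH ?andbF// expr0n gtn_eqF.
Qed.

Lemma stage_coef_le s i : normc (stage_coef s i) <= sd_bound (D s).
Proof.
rewrite /stage_coef; case: ifP => _; first exact: sd_coef_le (hD s) _.
by rewrite normc0; apply: le_trans (sd_bound_ge1 (hD s)).
Qed.

Lemma stage_power_small s q n k : (q <= s)%N -> (n <= H s)%N ->
  (0 < k <= s.+1)%N -> p q (iter n T (stage_power s k)) <= 2^-1 ^+ s.
Proof.
move=> qs nH ks; apply: hsmall => //; first exact: stage_coef_le.
by move=> i iN; rewrite /stage_coef leqNgt iN.
Qed.

Lemma stage_vector_mem : exists u : subseqspace X, val u = stage_vector.
Proof.
have [q s qs|i|u uE _] := @fsa_dyadic_series _ _ _ hX (stage_power ^~ 1%N) stage_vector.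
- by have := @stage_power_small s q 0 1 qs (leq0n _) isT; apply.
- exists (stage_of i).+1 => n sn; rewrite -[RHS]expr1 -(@sum_stage_entry i n 1)//.
  by apply: eq_bigr => s _; rewrite val_stage_power.
- by exists u.
Qed.

Lemma stage_time_bound s a : (a < N s)%N -> (N s + a * L s + L s <= H s.+1)%N.
Proof. by move=> aN; rewrite hHS mulnS -addnA leq_add2l -mulSnr leq_mul2r aN orbT. Qed.

Lemma stage_coef_periodic s a j : (a < N s)%N ->
  (N s + a * L s + j < H s.+1)%N ->
  stage_coef s (N s + a * L s + j) = sd_coef (D s) (j %% L s).
Proof.
move=> aN jH; rewrite /stage_coef jH andbT -addnA leq_addr addKn.
by rewrite modnMDl.
Qed.

(** The power of the root cancels [W (n + j)], leaving the [m s]-th power of the coefficient over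
    [W j]. For [j < L s] this is the target; the copies from later blocks form a tail controlled by
    [sd_gap_tail]. *)
Lemma iter_stage_power_main s a : (a < N s)%N ->
  p (r s) (iter (N s + a * L s) T (stage_power s (m s)) -
           basis_sum e (L s) (v s)) <= (r s).+1%:R^-1.
Proof.
move=> aN; set n := (N s + a * L s)%N.
have nL : (n + L s <= H s.+1)%N := stage_time_bound aN.
pose b j := if (j < L s)%N then 0 else sd_coef (D s) (j %% L s) ^+ m s.
have bE : iter n T (stage_power s (m s)) - basis_sum e (L s) (v s) =
    basis_sum e (H s.+1 - n) (fun j => b j / W j).
  apply/val_inj/funext => j.
  rewrite [LHS](_ : _ = val (iter n T (stage_power s (m s))) j -
                        val (basis_sum e (L s) (v s)) j)//.
  rewrite (val_iter_shift hw hT) !val_basis_sum// ltn_subRL.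
  have [jH|Hj] := ltnP (n + j)%N (H s.+1); last first.
    (* Past the end of the stage [j >= L s], since the block starting at [n] fits inside it; so the
       target vanishes there too. *)
    by rewrite mulr0 sub0r ifN ?oppr0// -leqNgt -(leq_add2l n) (leq_trans nL).
  rewrite /stage_entry stage_coef_periodic// exprMn /b.
  rewrite (_ : W (n + j) / W j * _ = rt (m s) (n + j) ^+ m s * W (n + j) *
    (sd_coef (D s) (j %% L s) ^+ m s / W j)); last by ring.
  rewrite hrt// mul1r.
  case: ifPn => jL; last by rewrite subr0.
  by rewrite modn_small// (sd_coefE (hD s)) mulfK ?weight_prod_neq0// subrr mul0r.
rewrite bE; apply: sd_gap_tail (hD s) _ _ _ _ => j.
  rewrite /b; case: ifP => _; last first.
    by rewrite normcX lerXn2r ?nnegrE ?normc_ge0// ?(sd_coef_le (hD s))//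
      (le_trans _ (sd_bound_ge1 (hD s))).
  by rewrite normc0 exprn_ge0// (le_trans _ (sd_bound_ge1 (hD s))).
by rewrite /b => ->.
Qed.

(** After the cancellation the root keeps the positive exponent [k - m s], giving a factor at most
    [sd_small]; [k <= (r s).+1] bounds the coefficients by the power in [sd_small_le]. *)
Lemma iter_stage_power_higher s a k : (a < N s)%N -> (m s < k <= (r s).+1)%N ->
  p (r s) (iter (N s + a * L s) T (stage_power s k)) <= (r s).+1%:R^-1.
Proof.
move=> aN /andP[mk kr]; set n := (N s + a * L s)%N.
have C0 : 0 <= sd_bound (D s) by apply: le_trans (sd_bound_ge1 (hD s)).
have /andP[d0 d1] := sd_small_gt0 (hD s).
pose b j := if (n + j < H s.+1)%N then
  sd_coef (D s) (j %% L s) ^+ k * rt (m s) (n + j) ^+ (k - m s) else 0.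
have -> : iter n T (stage_power s k) =
    basis_sum e (H s.+1 - n) (fun j => b j / W j).
  apply/val_inj/funext => j.
  rewrite (val_iter_shift hw hT) !val_basis_sum// ltn_subRL.
  case: ifPn => jH; last by rewrite mulr0.
  rewrite /stage_entry stage_coef_periodic// exprMn /b jH.
  have -> : rt (m s) (n + j)%N ^+ k =
      rt (m s) (n + j)%N ^+ m s * rt (m s) (n + j)%N ^+ (k - m s).
    by rewrite -exprD subnKC// ltnW.
  rewrite (_ : W (n + j) / W j * _ = rt (m s) (n + j) ^+ m s * W (n + j) *
    (sd_coef (D s) (j %% L s) ^+ k * rt (m s) (n + j) ^+ (k - m s) / W j)).
    by rewrite hrt// mul1r.
  by ring.
apply: sd_small_le (hD s) _ _ _ => j; rewrite /b; case: ifP => _; last first.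
  by rewrite normc0 mulr_ge0 ?exprn_ge0// ltW.
rewrite normcM !normcX; apply: ler_pM; rewrite ?exprn_ge0 ?normc_ge0//.
  apply: (@le_trans _ _ (sd_bound (D s) ^+ k)).
    by rewrite lerXn2r ?nnegrE ?normc_ge0// (sd_coef_le (hD s)).
  by rewrite ler_weXn2l// (sd_bound_ge1 (hD s)).
have rn : normc (rt (m s) (n + j)%N) <= sd_small (D s).
  by apply: hrtN; rewrite -addnA leq_addr.
rewrite -(subnSK mk) exprS; apply: le_trans rn.
by rewrite ler_piMr ?exprn_ile1 ?normc_ge0// (le_trans _ d1)// hrtN// -addnA leq_addr.
Qed.

(** Earlier stages lie to the left of [N s] and are erased by the shift; each later stage [t]
    contributes at most [2^-1 ^+ t], since the time is at most [H t]. *)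
Lemma iter_power_stage_close s a k (x : subseqspace X) :
  (a < N s)%N -> (0 < k <= s.+1)%N ->
  val x = (fun i => stage_vector i ^+ k) ->
  forall q, (q <= s)%N ->
  p q (iter (N s + a * L s) T x - iter (N s + a * L s) T (stage_power s k))
    <= 2^-1 ^+ s.
Proof.
move=> aN /andP[k0 ks] xE q qs; set n := (N s + a * L s)%N.
have nH : (n <= H s.+1)%N.
  by apply: leq_trans (stage_time_bound aN); rewrite leq_addr.
pose y t := if (t <= s)%N then 0 else iter n T (stage_power t k).
pose d := iter n T x - iter n T (stage_power s k).
have [q' t q't|i|l lE lb] := @fsa_dyadic_series _ _ _ hX y (val d).
- rewrite /y; case: leqP => [_|st].
    by rewrite sn0 exprn_ge0// invr_ge0.
  apply: stage_power_small => //; first exact: leq_trans (stage_end_homo st).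
  by rewrite k0 (leq_trans ks)// ltnS ltnW.
- exists (maxn s (stage_of (n + i))).+1 => J; rewrite gtn_max => /andP[sJ iJ].
  pose g := W (n + i) / W i.
  have yE t : val (y t) i = g * stage_entry t (n + i) ^+ k
      - (if t == s then g * stage_entry t (n + i) ^+ k else 0).
    rewrite /y; case: ltngtP => [ts|st|->]; last by rewrite subrr.
      rewrite stage_entry_out ?expr0n ?gtn_eqF//= ?mulr0 ?subr0//.
      rewrite negb_and -leqNgt; apply/orP; right.
      apply: leq_trans (stage_end_homo ts) _; apply: leq_trans (hHN s) _.
      by rewrite -addnA leq_addr.
    by rewrite (val_iter_shift hw hT) val_stage_power// subr0.
  rewrite (eq_bigr _ (fun t _ => yE t)) sumrB -mulr_sumr sum_stage_entry//.
  rewrite -big_mkcond big_nat1_eq sJ /=.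
  rewrite [RHS](_ : _ = val (iter n T x) i - val (iter n T (stage_power s k)) i)//.
  by rewrite !(val_iter_shift hw hT) xE val_stage_power.
(* The partial sum up to [s.+1] is zero, and twice [2^-1 ^+ s.+1] is [2^-1 ^+ s]. *)
have := lb q s.+1 (leqW qs).
rewrite big_nat big1 ?subr0; last first.
  by move=> t; rewrite ltnS /y => /= ->.
by rewrite exprS mulrA divff// mul1r (val_inj lE).
Qed.

Lemma iter_power_approx s a k (x : subseqspace X) :
  (a < N s)%N -> (m s <= k <= (r s).+1)%N -> (r s <= s)%N ->
  val x = (fun i => stage_vector i ^+ k) ->
  p (r s) (iter (N s + a * L s) T x -
           (if k == m s then basis_sum e (L s) (v s) else 0))
    <= (r s).+1%:R^-1 + 2^-1 ^+ s.
Proof.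
move=> aN /andP[mk kr] rs xE; set n := (N s + a * L s)%N.
have k0 : (0 < k)%N by apply: leq_trans mk.
have close : p (r s) (iter n T x - iter n T (stage_power s k)) <= 2^-1 ^+ s.
  by apply: iter_power_stage_close; rewrite ?k0 ?(leq_trans kr).
set z := (if _ then _ else _).
have -> : iter n T x - z = (iter n T (stage_power s k) - z) +
    (iter n T x - iter n T (stage_power s k)).
  by rewrite [RHS]addrC addrA subrK.
apply: le_trans (snD _ _ _ _) _; rewrite lerD// /z.
case: eqP => [->|/eqP km]; first exact: iter_stage_power_main.
by rewrite subr0 iter_stage_power_higher// ltn_neqAle eq_sym km mk.
Qed.

End Stages.

(** * Upper density and rational targets *)

(** The assumed series starts at index 1; one more initial term does not change the tails. *)
Lemma multiplier_summable_shift (R : realType) (E : lmodType R[i])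
    (p : seminorm_seq E) (x : nat -> E) :
  multiplier_summable p (fun n => x n.+1) -> multiplier_summable p x.
Proof.
move=> sx q d d0; have [N NP] := sx q d d0; exists N.+1 => a [|K] a1 aN.
  by rewrite big_geq// sn0 ltW.
rewrite big_nat_recl// aN// scale0r add0r.
by apply: (NP (fun i => a i.+1)) => i // iN; exact: aN.
Qed.

(** At least [N] of the times up to [N * L.+1] lie in [A], a proportion [L.+1%:R^-1], and [N] can be
    arbitrarily large. *)
Lemma upper_density_gt0 (R : realType) (A : set nat) (L : nat) : (0 < L)%N ->
  (forall S, exists N, [/\ (S <= N)%N, (0 < N)%N &
    forall a, (a < N)%N -> A (N + a * L)%N]) ->
  (0 < upper_density R A)%E.
Proof.
move=> L0 AP; apply: (@lt_le_trans _ _ ((L.+1%:R^-1 : R)%:E)).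
  by rewrite lte_fin invr_gt0.
rewrite /upper_density; apply: le_ereal_inf_tmp => _ [V [M _ MV] <-].
have [N [MN N0 NA]] := AP M.
have count b : (b <= N)%N ->
    (b%:R : R) <= \sum_(1 <= n < N + b * L) \1_A n.
  elim: b => [_|b IHb bN]; first by apply: sumr_ge0 => n _; rewrite indicE ler0n.
  rewrite (@big_cat_nat _ _ _ (N + b * L))//=; last 2 first.
  - by rewrite addn_gt0 N0.
  - by rewrite leq_add2l leq_mul2r leqnSn orbT.
  rewrite -natr1 lerD ?IHb ?(ltnW bN)//.
  rewrite big_ltn; last by rewrite ltn_add2l ltn_mul2r L0 leqnn.
  rewrite indicE (mem_set (NA b bN)) lerDl; apply: sumr_ge0 => n _.
  by rewrite indicE ler0n.
pose n0 := (N * L.+1)%N.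
have n0R : 0 < n0%:R :> R by rewrite ltr0n muln_gt0 N0.
apply: (@le_trans _ _ ((\sum_(1 <= n < n0.+1) \1_A n / n0%:R : R)%:E)); last first.
  apply: ereal_sup_ubound; exists n0; last by rewrite mulr_suml.
  by apply: MV => /=; rewrite (leq_trans MN)// leq_pmulr.
rewrite lee_fin -mulr_suml ler_pdivlMr// natrM mulrCA mulVf ?pnatr_eq0// mulr1.
apply: le_trans (count N (leqnn N)) _.
rewrite -mulnS [leRHS](@big_cat_nat _ _ _ n0)//= ?muln_gt0 ?N0// lerDl.
by apply: sumr_ge0 => n _; rewrite indicE ler0n.
Qed.

Section RationalTargets.
Context (R : realType).

Definition complex_of_rats (a : rat * rat) : R[i] := ratr a.1 +i* ratr a.2.

Lemma complex_of_rats_dense (z : R[i]) (d : R) : 0 < d ->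
  exists a, normc (z - complex_of_rats a) <= d.
Proof.
have approx (t c : R) : 0 < c -> exists a : rat, `|t - ratr a| <= c.
  move=> c0; have /rat_in_itvoo[a] : t - c < t + c by lra.
  rewrite in_itv/= => /andP[ta at_]; exists a.
  by rewrite ler_norml; apply/andP; split; lra.
move=> d0; case: z => x y.
have d20 : 0 < d / 2 by lra.
have [a xa] := approx x _ d20; have [b yb] := approx y _ d20.
exists (a, b); apply: le_trans (normc_le_abs_ReIm _) _ => /=.
by rewrite (splitr d); exact: lerD.
Qed.

Definition rational_coef (l : seq (rat * rat)) (j : nat) : R[i] :=
  nth 0 (map complex_of_rats l) j.

Lemma rational_coef_supp l j : (size l <= j)%N -> rational_coef l j = 0.
Proof. by move=> lj; rewrite /rational_coef nth_default// size_map. Qed.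

Lemma rational_basis_sum_dense (X : submodClosed (nat -> R[i]))
    (p : seminorm_seq (subseqspace X)) (e : nat -> subseqspace X) n c q (d : R) :
  0 < d -> exists2 l, size l = n &
    p q (basis_sum e n c - basis_sum e n (rational_coef l)) <= d.
Proof.
move=> d0; pose B := 1 + \sum_(0 <= i < n) p q (e i).
have B0 : 0 < B.
  by rewrite ltr_pwDl// sumr_ge0// => i _; exact: sn_ge0.
have [f fP] := choice (fun j => complex_of_rats_dense (c j) (divr_gt0 d0 B0)).
exists (mkseq f n); first by rewrite size_mkseq.
rewrite -sumrB.
apply: (@le_trans _ _ (\sum_(0 <= i < n) d / B * p q (e i))).
  apply: sn_sum_nat => i /andP[_ ni]; rewrite -scalerBl snZ ler_wpM2r ?sn_ge0//.
  by rewrite /rational_coef -map_comp (nth_map 0%N) ?size_iota// nth_iota// fP.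
rewrite -mulr_sumr mulrAC ler_pdivrMr// ler_wpM2l ?(ltW d0)//.
by rewrite /B lerDr.
Qed.

(** [s] codes a triple with a dummy number; forgetting the latter makes each triple recur infinitely
    often. *)
Definition target_of (s : nat) : seq (rat * rat) * nat * nat :=
  if unpickle s is Some ti then (ti : _ * nat).1
  else ([::], 0%N, 0%N).

Lemma target_of_infinitely_often t S : exists2 s, (S <= s)%N & target_of s = t.
Proof.
pose f i := pickle (t, i : nat).
have [i Si] : exists i, (S <= f i)%N.
  (* Otherwise the injective coding would embed [S.+1] numbers into [S] of them. *)
  apply: contrapT => /forallNP no.
  have lt i : (f i < S)%N by rewrite ltnNge; apply/negP/no.
  have inj : injective (fun i : 'I_S.+1 => Ordinal (lt i)).
    move=> i j [] /(congr1 (@unpickle (seq (rat * rat) * nat * nat * nat)%type)).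
    by rewrite !pickleK => -[] /val_inj.
  by have := leq_card _ inj; rewrite !card_ord ltnn.
by exists (f i) => //; rewrite /target_of pickleK.
Qed.

End RationalTargets.

(** * The algebra generated by one vector *)

Section UniversalVector.
Context (R : realType) (X : submodClosed (nat -> R[i])).
Context (p : seminorm_seq (subseqspace X)) (e : nat -> subseqspace X).
Context (hX : frechet_sequence_algebra p) (hn : has_continuous_norm p).
Context (he : forall n, val (e n) = unit_seq R n).
Context (w : nat -> R[i]) (hw : forall n, (0 < n)%N -> w n != 0).
Context (T : subseqspace X -> subseqspace X).
Context (hT : forall x, val (T x) = backward_shift w (val x)).
Context (hTc : continuous (T : sn_space p -> sn_space p)).
Context (rt : nat -> nat -> R[i]).
Context (hrt : forall m i, (0 < m)%N -> rt m i ^+ m * weight_prod w i = 1).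
Context (hsum : forall m, (0 < m)%N ->
  multiplier_summable p (fun i => rt m i *: e i)).

Definition rational_vector l := basis_sum e (size l) (rational_coef R l).

(* [u^m] visits a neighbourhood of each target, at times where the higher powers
   are small, along arithmetic progressions [N + a L] with [a < N], whose step
   [L] does not depend on [N]. *)
Definition powers_hit_targets (u : subseqspace X) :=
  forall (l : seq (rat * rat)) m r, (0 < m)%N -> exists2 L, (0 < L)%N &
  forall S, exists N, [/\ (S <= N)%N, (0 < N)%N &
  forall a k (x : subseqspace X), (a < N)%N -> (m <= k <= r.+1)%N ->
    val x = (fun i => val u i ^+ k) ->
    p r (iter (N + a * L) T x - (if k == m then rational_vector l else 0))
      <= 2 / r.+1%:R].

(** The stages are fixed by recursion: [H s] determines the start [N s], which determines
    [H s.+1]. *)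
Lemma powers_hit_targets_exists : exists u, powers_hit_targets u.
Proof.
have dataP (t : seq (rat * rat) * nat * nat) : exists D,
    stage_data_for p e w (rational_coef R t.1.1) t.1.2.+1 t.2 D.
  by apply: (stage_data_exists hw hrt hsum) => //; exact: rational_coef_supp.
(* The data are chosen per target, not per stage, so the gap is the same at every recurrence of the
   target. *)
have {dataP} [D' D'P] := choice dataP.
pose v s := rational_coef R (target_of s).1.1.
pose m s := (target_of s).1.2.+1.
pose r s := (target_of s).2.
pose D s := D' (target_of s).
have DP s : stage_data_for p e w (v s) (m s) (r s) (D s) by exact: D'P.
have startP (sH : nat * nat) := stage_start_exists he hw hT hsum hTc sH.1 sH.2
  hX hn (isT : (0 < m sH.1)%N) (sd_bound_ge1 (DP sH.1)) (sd_small_gt0 (DP sH.1)).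
have {startP} [Nf NfP] := choice startP.
pose H := fix H s :=
  if s is s'.+1 then (Nf (s', H s') * (sd_gap (D s')).+1)%N else 0%N.
pose N s := Nf (s, H s).
have N0 s : (0 < N s)%N by have [] := NfP (s, H s).
have HN s : (H s <= N s)%N by have [] := NfP (s, H s).
have HS s : H s.+1 = (N s * (sd_gap (D s)).+1)%N by [].
have rtN s i : (N s <= i)%N -> normc (rt (m s) i) <= sd_small (D s).
  by have [_ _ h _] := NfP (s, H s); exact: h.
have small s : _ := let: And4 _ _ _ h := NfP (s, H s) in h.
have [u uE] := stage_vector_mem hX he DP N0 HN HS small.
exists u => l k0 r0; case: k0 => // m0 _.
pose t := (l, m0, r0).
exists (sd_gap (D' t)); first exact: sd_gap_gt0 (D'P t).
(* [s >= S] makes the times late; [s >= r0] makes the estimates available in the seminorm of index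
   [r0]. *)
move=> S; have [s Ss st] := target_of_infinitely_often t (maxn S r0).
move: Ss; rewrite geq_max => /andP[Ss rs].
have sN : (s <= N s)%N.
  apply: leq_trans (HN s); elim: (s) => // j /leq_ltn_trans; apply.
  exact: (stage_end_lt DP N0 HN HS).
exists (N s); split => //; first exact: leq_trans sN.
move=> a k x aN mk xE.
have := @iter_power_approx _ _ _ _ hX he _ hw _ hT _ hrt v m r D N H
  (fun=> isT) DP N0 HN HS rtN small s a k x aN.
have -> : basis_sum e (sd_gap (D s)) (v s) = rational_vector l.
  apply/val_inj/funext => j; rewrite !val_basis_sum//.
  have vE : v s = rational_coef R l by rewrite /v st.
  case: ifPn; rewrite -?leqNgt => Lj.
    by rewrite vE; case: ifPn => //; rewrite -leqNgt => /(rational_coef_supp R).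
  case: ifPn => // _; rewrite -vE; symmetry; exact: sd_gap_supp (DP s) _ Lj.
rewrite /m /r /D st; move=> h; apply: le_trans (h mk rs _) _.
  by rewrite -uE.
rewrite mulr_natl [leRHS]mulr2n.
(* The error [2^-1 ^+ s] is at most [r0.+1%:R^-1], since [r0 < 2 ^ r0] and [r0 <= s]. *)
rewrite lerD2l exprVn lef_pV2 ?posrE ?exprn_gt0 ?ltr0n//.
rewrite -natrX ler_nat; apply: leq_trans (ltn_expl r0 (isT : (1 < 2)%N)) _.
by rewrite leq_exp2l.
Qed.

(** * Linearity of the iterates and polynomials in one vector *)

Lemma iter_shift_linear n (a : R[i]) x y :
  iter n T (a *: x + y) = a *: iter n T x + iter n T y.
Proof.
apply/val_inj/funext => k.
rewrite [RHS](_ : _ = a * val (iter n T x) k + val (iter n T y) k)//.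
rewrite !(val_iter_shift hw hT).
rewrite [X in _ * X](_ : _ = a * val x (n + k)%N + val y (n + k)%N)//.
by rewrite mulrDr mulrCA.
Qed.

Lemma iter_shift0 n : iter n T 0 = 0.
Proof. by apply/val_inj/funext => k; rewrite (val_iter_shift hw hT) mulr0. Qed.

Lemma iter_shiftZ n a x : iter n T (a *: x) = a *: iter n T x.
Proof. by rewrite -[a *: x]addr0 iter_shift_linear iter_shift0 addr0. Qed.

Lemma iter_shift_sum n (I : Type) (s : seq I) (P : pred I) (F : I -> subseqspace X) :
  iter n T (\sum_(i <- s | P i) F i) = \sum_(i <- s | P i) iter n T (F i).
Proof.
elim/big_rec2: _ => [|i y z _ <-]; first exact: iter_shift0.
by have := iter_shift_linear n 1 (F i) z; rewrite !scale1r.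
Qed.

(** The constant term is zero because [X] is not assumed to contain the constant sequences. *)
Definition horner_orbit (u : nat -> R[i]) (x : nat -> R[i]) :=
  exists2 P : {poly R[i]}, P`_0 = 0 & x = (fun k => P.[u k]).

Lemma power_mem (u : subseqspace X) k : (0 < k)%N ->
  exists x : subseqspace X, val x = (fun i => val u i ^+ k).
Proof.
elim: k => // -[_ _|k IHk _]; first by exists u; apply/funext => i; rewrite expr1.
have [x xE] := IHk isT.
have xuX : val u * val x \in X by apply: fsa_mul_closed hX _ _ _ _; exact: valP.
exists (exist (fun z => z \in X) _ xuX : subseqspace X); apply/funext => i.
by rewrite exprS -(congr1 (fun f => f i) xE).
Qed.

Lemma powers_mem (u : subseqspace X) : exists y : nat -> subseqspace X,
  forall k, (0 < k)%N -> val (y k) = (fun i => val u i ^+ k).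
Proof.
have powE k : exists x : subseqspace X,
    (0 < k)%N -> val x = (fun i => val u i ^+ k).
  (* At [k = 0] the value is a placeholder, later multiplied by the zero constant coefficient. *)
  by case: (posnP k) => [->|/(power_mem u)[x xE]]; [exists 0|exists x].
by have [y yE] := choice powE; exists y.
Qed.

Lemma horner_orbit_val (u : subseqspace X) (y : nat -> subseqspace X)
    (P : {poly R[i]}) :
  (forall k, (0 < k)%N -> val (y k) = (fun i => val u i ^+ k)) -> P`_0 = 0 ->
  val (\sum_(0 <= k < size P) P`_k *: y k) = (fun i => P.[val u i]).
Proof.
move=> yE P0; apply/funext => i; rewrite val_sum horner_coef.
rewrite -(big_mkord xpredT (fun k => P`_k * val u i ^+ k)).
apply: eq_bigr => -[_|k _].
  by rewrite P0 mul0r scale0r.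
by rewrite [LHS](_ : _ = P`_k.+1 * val (y k.+1) i)// yE.
Qed.

(** The orbit of 0 stays at 0, which is at distance at least 1 from the target [e 0] in large
    seminorms. *)
Lemma powers_hit_targets_neq0 u : powers_hit_targets u -> val u <> (fun=> 0).
Proof.
move=> uP u0.
have [q0 q0P] := continuous_norm_unit_ge1 he hX hn.
(* Index at least [q0] for the lower bound 1, and at least 3 so that [2 / r.+1%:R] is below 1. *)
have [L _ LP] := uP [:: (1, 0)] 1%N (maxn q0 3) isT.
have [N [_ N0 NP]] := LP 0%N.
have := NP 0%N 1%N u N0; rewrite eqxx /= => /(_ isT).
have -> : iter (N + 0 * L) T u = 0.
  by apply/val_inj/funext => k; rewrite (val_iter_shift hw hT) u0 mulr0.
rewrite sub0r snN.
have -> : rational_vector [:: (1, 0)] = e 0%N.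
  rewrite /rational_vector /basis_sum big_nat1 /rational_coef/=.
  by rewrite /complex_of_rats/= rmorph1 rmorph0 scale1r.
have r4 : (2 / (maxn q0 3).+1%:R : R) < 1.
  by rewrite ltr_pdivrMr// mul1r ltr_nat ltnS leq_max orbT.
have uX1 : val u = (fun i => val u i ^+ 1) by apply/funext => k; rewrite expr1.
by move=> /(_ uX1) h; have := le_lt_trans h r4; rewrite ltNge q0P// leq_maxl.
Qed.

(** Dividing the target by the lowest nonzero coefficient of [P] makes the lowest term hit [z],
    while the higher powers are small at the same times. *)
Lemma orbit_upper_frequently_hypercyclic (u x : subseqspace X) :
  dense (linear_span (e : nat -> sn_space p)) ->
  powers_hit_targets u ->
  horner_orbit (val u) (val x) -> x != 0 ->
  upper_frequently_hypercyclic R (T : sn_space p -> sn_space p) x.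
Proof.
move=> hd uP [P P0 xP] x0 U Uo U0.
have [z [Uz [n [c zE]]]] := hd U U0 Uo.
have [q [d d0 dU]] := sn_open_ball Uo Uz.
have [y yE] := powers_mem u.
have xE : x = \sum_(0 <= k < size P) P`_k *: y k.
  by apply/val_inj; rewrite xP (horner_orbit_val yE).
have exm : exists m, P`_m != 0.
  apply: contrapT => /forallNP Pz; move/eqP: x0; apply.
  rewrite xE big1// => k _.
  by have /negP/negbNE/eqP -> := Pz k; rewrite scale0r.
have [m Pm mmin] := ex_minnP exm.
have m0 : (0 < m)%N by rewrite lt0n; apply: contra Pm => /eqP ->; rewrite P0.
have msize : (m < size P)%N.
  by rewrite ltnNge; apply: contra Pm => /(nth_default 0) ->.
have nPm : 0 < normc P`_m by exact: normc_gt0.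
have d3 : 0 < d / 3 / normc P`_m by rewrite !divr_gt0.
have [l ln lz] := rational_basis_sum_dense p e n (fun k => c k / P`_m) q d3.
pose M := 1 + \sum_(m <= k < size P) normc P`_k.
have M0 : 0 < M by rewrite ltr_pwDl// sumr_ge0// => k _; exact: normc_ge0.
(* The bound [d / (6 * M)] makes the total error [M * (2 / r.+1%:R)] less than [d / 3]. *)
have [r0 r0P] := ltr_add_invr (divr_gt0 d0 (mulr_gt0 (ltr0Sn R 5) M0)).
(* Large enough for the seminorm [q], for all degrees occurring in [P], and for the precision. *)
pose r := maxn (maxn q (size P)) r0.
have [L L0 LP] := uP l m r m0.
apply: (upper_density_gt0 _ L0) => S; have [N [SN N0 NP]] := LP S.
exists N; split => // a aN /=; apply: dU; set t := (N + a * L)%N.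
pose g k := if k == m then rational_vector l else 0.
have zsum : z = \sum_(0 <= k < n) c k *: e k by rewrite zE big_mkord.
have split_diff : (z : subseqspace X) - iter t T x =
    P`_m *: (basis_sum e n (fun k => c k / P`_m) - rational_vector l)
    - \sum_(m <= k < size P) P`_k *: (iter t T (y k) - g k).
  have -> : P`_m *: (basis_sum e n (fun k => c k / P`_m) - rational_vector l) =
      z - P`_m *: rational_vector l.
    rewrite scalerBr scaler_sumr zsum; congr (_ - _); apply: eq_bigr => k _.
    by rewrite scalerA mulrCA divff// mulr1.
  have -> : \sum_(m <= k < size P) P`_k *: (iter t T (y k) - g k) =
      iter t T x - P`_m *: rational_vector l.
    rewrite (eq_bigr _ (fun k _ => scalerBr _ _ _)) sumrB; congr (_ - _).
      rewrite xE iter_shift_sum [RHS](@big_cat_nat _ _ _ m)//= ?(ltnW msize)//.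
      rewrite [X in _ = X + _]big_nat [X in _ = X + _]big1 ?add0r.
        by apply: eq_bigr => k _; rewrite iter_shiftZ.
      move=> k /andP[_ km]; have [->|/mmin] := eqVneq P`_k 0; last by rewrite leqNgt km.
      by rewrite scale0r iter_shift0.
    rewrite big_ltn// /g eqxx big_nat big1 ?addr0// => k /andP[mk _].
    by rewrite gtn_eqF// scaler0.
  by rewrite opprB [RHS]addrA subrK.
rewrite [X in p q X]split_diff; apply: le_lt_trans (snD _ _ _ _) _; rewrite snN snZ.
have h1 : normc P`_m * p q (basis_sum e n (fun k => c k / P`_m) - rational_vector l)
    <= d / 3.
  by rewrite mulrC -ler_pdivlMr// /rational_vector ln.
have h2 : p q (\sum_(m <= k < size P) P`_k *: (iter t T (y k) - g k))
    <= M * (2 / r.+1%:R).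
  apply: (@le_trans _ _ (\sum_(m <= k < size P) normc P`_k * (2 / r.+1%:R))).
    apply: sn_sum_nat => k /andP[mk kP]; rewrite snZ ler_wpM2l ?normc_ge0//.
    have qr : (q <= r)%N by rewrite /r !leq_max leqnn.
    apply: le_trans (sn_homo _ _ qr) _; apply: NP => //.
      by rewrite mk ltnW// ltnS /r !leq_max (ltnW kP) orbT.
    by apply: yE; exact: leq_trans mk.
  by rewrite -mulr_suml ler_wpM2r ?divr_ge0// /M lerDr.
have h3 : M * (2 / r.+1%:R) < d / 3.
  rewrite add0r in r0P.
  have rr : (r.+1%:R^-1 : R) <= r0.+1%:R^-1.
    by rewrite lef_pV2 ?posrE ?ltr0n// ler_nat ltnS /r leq_max leqnn orbT.
  have := le_lt_trans rr r0P; rewrite ltr_pdivlMr ?mulr_gt0//.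
  by set i := r.+1%:R^-1; lra.
by apply: le_lt_trans (lerD h1 (le_trans h2 (ltW h3))) _; lra.
Qed.

End UniversalVector.

(** * Existence of an upper frequently hypercyclic algebra *)

Theorem theorem1p4 (R : realType) (X : submodClosed (nat -> R[i]))
  (p : seminorm_seq (subseqspace X))
  (hX : frechet_sequence_algebra p)
  (hnorm : has_continuous_norm p)
  (e : nat -> sn_space p)
  (he : forall n, val (e n) = unit_seq R n)
  (hdense : dense (linear_span e))
  (w : nat -> R[i])
  (hw : forall n, (0 < n)%N -> w n != 0)
  (Bw : sn_space p -> sn_space p)
  (hBw : forall x, val (Bw x) = backward_shift w (val x))
  (hBw_cont : continuous Bw)
  (root : nat -> nat -> R[i])
  (hroot : forall m n, (0 < m)%N -> (0 < n)%N ->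
    root m n ^+ m = (\prod_(1 <= k < n.+1) w k)^-1)
  (huncond : forall m, (0 < m)%N ->
    unconditionally_cvg (fun n => root m n.+1 *: e n.+1)) :
  exists A : {pred nat -> R[i]}, ufh_algebra Bw A.
Proof.
(* The value 1 at index 0 is a root matching the empty product [W 0 = 1]. *)
pose rt m i := if i is 0%N then 1 else root m i.
have hrt m i : (0 < m)%N -> rt m i ^+ m * weight_prod w i = 1.
  case: i => [|i] m0; first by rewrite expr1n weight_prod0 mulr1.
  by rewrite /rt hroot// mulVf// (weight_prod_neq0 hw).
have hsum m : (0 < m)%N -> multiplier_summable p (fun i => rt m i *: e i).
  move=> m0; apply: multiplier_summable_shift.
  exact: unconditionally_cvg_multiplier (huncond m m0).
have [u uP] := powers_hit_targets_exists hX hnorm he hw hBw hBw_cont hrt hsum.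
exists (fun x => `[< horner_orbit (val u) x >]).
have [y yE] := powers_mem hX u.
split; first split.
- move=> x /asboolP[P P0 ->]; rewrite -(horner_orbit_val yE P0); exact: valP.
- split.
    apply/asboolP; exists 0; first by rewrite coef0.
    by apply/funext => k; rewrite horner0.
  move=> a x z /asboolP[P P0 ->] /asboolP[Q Q0 ->]; apply/asboolP.
  exists (a *: P + Q); first by rewrite coefD coefZ P0 Q0 mulr0 addr0.
  by apply/funext => k; rewrite hornerD hornerZ.
- move=> x z /asboolP[P P0 ->] /asboolP[Q Q0 ->]; apply/asboolP.
  exists (P * Q); first by rewrite coef0M P0 mul0r.
  by apply/funext => k; rewrite hornerM.
- exists (val u).
    apply/asboolP; exists 'X; first by rewrite coefX.
    by apply/funext => k; rewrite hornerX.
  by apply/eqP => u0; exact (powers_hit_targets_neq0 hX hnorm he hw hBw uP u0).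
- move=> x /asboolP xu x0.
  exact (orbit_upper_frequently_hypercyclic hX hw hBw hdense uP xu x0).
Qed.
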